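(* Let $A\in\mathbb{C}^{m\times n}$, $0\neq W\in\mathbb{C}^{n\times m}$ and $q\in\mathbb{N}\cup\{0\}$. There exists a unique matrix $X\in\mathbb{C}^{m\times n}$ satisfying the conditions $$P_{(AW)^q}X=(WAWP_{(AW)^q})^\dagger\quad\text{and}\quad\mathcal{R}(X)\subseteq\mathcal{R}((AW)^q),$$ and it is given by $X=A^{\diamond_q,W}$.
   Context: $B^\dagger$ denotes the Moore-Penrose inverse and $\mathcal{R}(B)$ the column space of $B$; $P_B:=BB^\dagger$ is the orthogonal projector onto $\mathcal{R}(B)$. By convention $(AW)^0=I_m$. The $W$-weighted $q$-BT inverse $A^{\diamond_q,W}$ is the unique $X\in\mathbb{C}^{m\times n}$ satisfying $XWAWX=X$, $XWA=(WAWP_{(AW)^q})^\dagger WA$, $AWX=AW(WAWP_{(AW)^q})^\dagger$; explicitly $A^{\diamond_q,W}=(WAWP_{(AW)^q})^\dagger$. *)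

(* Defs.v *)
From HB Require Import structures.
From mathcomp Require Import all_boot all_order all_algebra.
From mathcomp Require Import spectral.
From mathcomp Require Import complex.
From mathcomp Require Import reals.

Set Implicit Arguments.
Unset Strict Implicit.
Unset Printing Implicit Defensive.

Import Order.TTheory GRing.Theory Num.Theory.
Local Open Scope ring_scope.
Local Open Scope sesquilinear_scope.

Section MoorePenrose.
Variable C : numClosedFieldType.

(* [B ^t*] is the conjugate transpose of B. *)
Lemma ctmx_mul m n p (A : 'M[C]_(m, n)) (B : 'M[C]_(n, p)) :
  (A *m B) ^t* = B ^t* *m A ^t*.
Proof. by rewrite trmx_mul map_mxM. Qed.

(* The four Penrose equations. *)
Definition is_mpinv m n (B : 'M[C]_(m, n)) (X : 'M[C]_(n, m)) : bool :=
  [&& B *m X *m B == B,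
      X *m B *m X == X,
      (B *m X) ^t* == B *m X
    & (X *m B) ^t* == X *m B].

Lemma gram_unitmx r n (G : 'M[C]_(r, n)) :
  row_free G -> G *m G ^t* \in unitmx.
Proof.
move=> freeG; rewrite -row_free_unit -kermx_eq0.
apply/rowV0P => v /sub_kermxP vGG0.
have: (v *m G) *m (v *m G) ^t* = 0.
  by rewrite ctmx_mul -mulmxA (mulmxA G) mulmxA vGG0 mul0mx.
move=> /matrixP /(_ 0 0); rewrite -dotmxE mxE => /eqP.
rewrite dnorm_eq0 => /eqP vG0.
by apply: (row_free_inj freeG); rewrite vG0 mul0mx.
Qed.

Lemma mpinv_exists m n (B : 'M[C]_(m, n)) : exists X, is_mpinv B X.
Proof.
have [r [F [G [BE fullF freeG]]]] : exists r, exists F : 'M[C]_(m, r),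
    exists G : 'M[C]_(r, n), [/\ B = F *m G, row_full F & row_free G].
  exists (\rank B), (col_base B), (row_base B).
  by rewrite mulmx_base col_base_full row_base_free.
have uG : G *m G ^t* \in unitmx by apply: gram_unitmx.
have uF : F ^t* *m F \in unitmx.
  have := @gram_unitmx _ _ (F ^t*); rewrite trmxCK; apply.
  by rewrite /row_free mxrank_map mxrank_tr.
pose g := G ^t* *m invmx (G *m G ^t*).
pose f := invmx (F ^t* *m F) *m F ^t*.
have Gg : G *m g = 1%:M by rewrite mulmxA mulmxV.
have fF : f *m F = 1%:M by rewrite -mulmxA mulVmx.
have BX : B *m (g *m f) = F *m f.
  by rewrite BE -mulmxA (mulmxA G) Gg mul1mx.
have XB : (g *m f) *m B = g *m G.
  by rewrite BE -mulmxA (mulmxA f) fF mul1mx.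
have herm k (M : 'M[C]_k) : M ^t* = M -> (invmx M) ^t* = invmx M.
  by move=> MM; rewrite trmx_inv map_invmx MM.
exists (g *m f); apply/and4P; rewrite BX XB; split; apply/eqP.
- by rewrite BE -mulmxA (mulmxA f) fF mul1mx.
- by rewrite -mulmxA (mulmxA G) Gg mul1mx.
- by rewrite /f mulmxA !ctmx_mul trmxCK herm ?ctmx_mul ?trmxCK// mulmxA.
- by rewrite /g !ctmx_mul trmxCK herm ?ctmx_mul ?trmxCK// mulmxA.
Qed.

Lemma mpinv_unique m n (B : 'M[C]_(m, n)) X Y :
  is_mpinv B X -> is_mpinv B Y -> X = Y.
Proof.
move=> /and4P[/eqP BXB /eqP XBX /eqP hBX /eqP hXB].
move=> /and4P[/eqP BYB /eqP YBY /eqP hBY /eqP hYB].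
have eBX : B *m X = B *m Y.
  by rewrite -hBX -[in LHS]BYB -[B *m Y *m B *m X]mulmxA ctmx_mul hBX hBY
             mulmxA BXB.
have eXB : X *m B = Y *m B.
  rewrite -hXB -[in LHS]BYB -(mulmxA B) [X *m (B *m _)]mulmxA ctmx_mul hXB hYB.
  by rewrite -(mulmxA Y) (mulmxA B X) BXB.
by rewrite -XBX eXB -mulmxA eBX mulmxA YBY.
Qed.

Definition mpinv m n (B : 'M[C]_(m, n)) : 'M[C]_(n, m) :=
  xchoose (mpinv_exists B).

Lemma mpinvP m n (B : 'M[C]_(m, n)) : is_mpinv B (mpinv B).
Proof. exact: xchooseP. Qed.

Definition orthoproj m n (B : 'M[C]_(m, n)) : 'M[C]_m := B *m mpinv B.

(* R(X) is contained in R(B).  MathComp's [<=%MS] compares row spaces, and the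
   column space of a matrix is the row space of its transpose. *)
Definition colspace_sub m n p (X : 'M[C]_(m, n)) (B : 'M[C]_(m, p)) : bool :=
  (X^T <= B^T)%MS.

Lemma colspace_subP m n p (X : 'M[C]_(m, n)) (B : 'M[C]_(m, p)) :
  reflect (forall v : 'cV[C]_n, exists u : 'cV[C]_p, X *m v = B *m u)
          (colspace_sub X B).
Proof.
apply: (iffP idP) => [/submxP[D XD] v|XB].
  exists (D^T *m v); rewrite mulmxA; congr (_ *m _).
  by apply: trmx_inj; rewrite XD trmx_mul trmxK.
apply/row_subP => i; have [u Xu] := XB (delta_mx i 0).
by rewrite -tr_col colE Xu trmx_mul submxMl.
Qed.

Section WeightedBT.
Variables (m n : nat) (A : 'M[C]_(m, n)) (W : 'M[C]_(n, m)) (q : nat).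

Definition wqBT_core : 'M[C]_(n, m) :=
  W *m A *m W *m orthoproj ((A *m W) ^+ q).

Definition is_wqBT (X : 'M[C]_(m, n)) : bool :=
  [&& X *m W *m A *m W *m X == X,
      X *m W *m A == mpinv wqBT_core *m W *m A
    & A *m W *m X == A *m W *m mpinv wqBT_core].

Lemma orthoproj_mpinv_core :
  orthoproj ((A *m W) ^+ q) *m mpinv wqBT_core = mpinv wqBT_core.
Proof.
set P := orthoproj _; have /and4P[_ /eqP XBX _ /eqP hXB] := mpinvP wqBT_core.
have /and4P[/eqP K1 _ /eqP hP _] := mpinvP ((A *m W) ^+ q).
have PP : P *m P = P by rewrite /P /orthoproj mulmxA K1.
have PXB : P *m (mpinv wqBT_core *m wqBT_core) = mpinv wqBT_core *m wqBT_core.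
  rewrite -hXB ctmx_mul {1 3}/wqBT_core -/P.
  by rewrite ctmx_mul (hP : P ^t* = P) -(mulmxA P) (mulmxA P P) PP.
by rewrite -[in LHS]XBX mulmxA PXB XBX.
Qed.

Lemma is_wqBT_mpinv : is_wqBT (mpinv wqBT_core).
Proof.
rewrite /is_wqBT !eqxx !andbT; apply/eqP.
have /and4P[_ /eqP XBX _ _] := mpinvP wqBT_core.
have BX : wqBT_core *m mpinv wqBT_core = W *m A *m W *m mpinv wqBT_core.
  by rewrite {1}/wqBT_core -mulmxA orthoproj_mpinv_core.
by rewrite -[RHS]XBX -[RHS]mulmxA BX !mulmxA.
Qed.

Lemma wqBT_exists : exists X, is_wqBT X.
Proof. by exists (mpinv wqBT_core); apply: is_wqBT_mpinv. Qed.

Lemma wqBT_unique X Y : is_wqBT X -> is_wqBT Y -> X = Y.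
Proof.
move=> /and3P[/eqP X1 /eqP X2 /eqP X3] /and3P[/eqP Y1 /eqP Y2 /eqP Y3].
rewrite -X1 -Y1 X2 Y2 -!(mulmxA _ W) -!(mulmxA (mpinv _)) -!(mulmxA W).
by rewrite !(mulmxA A W) X3 Y3.
Qed.

(* The W-weighted q-BT inverse of A. *)
Definition wqBT : 'M[C]_(m, n) := xchoose wqBT_exists.

Lemma wqBTP : is_wqBT wqBT.
Proof. exact: xchooseP. Qed.

Lemma wqBTE : wqBT = mpinv wqBT_core.
Proof. by apply: wqBT_unique; [apply: wqBTP | apply: is_wqBT_mpinv]. Qed.

End WeightedBT.
End MoorePenrose.

(* Main.v *)
Require Import Defs.
From mathcomp Require Import all_boot all_order all_algebra.
From mathcomp Require Import complex reals.

Local Open Scope ring_scope.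
Local Open Scope complex_scope.

(** An orthogonal projector acts as the identity on matrices whose columns lie
    in its range. Hence, once the columns of [X] lie in the range of
    [(A *m W) ^+ q], the equation [P *m X = Z] merely says [X = Z], and at most
    one [X] is possible. With [Z] the Moore-Penrose inverse of
    [W *m A *m W *m P], this [Z] is an actual solution: [P *m Z = Z]
    ([orthoproj_mpinv_core]), because the range of [Z] is that of the conjugate
    transpose of [W *m A *m W *m P], whose leftmost factor is the Hermitian
    matrix [P]. Finally [Z] is the weighted q-BT inverse ([wqBTE]). *)

(** A matrix with columns in the range of [B] factors as [B *m D], and the
    first Penrose equation says that [orthoproj B] fixes [B]. *)
Lemma orthoproj_id (C : numClosedFieldType) (m n p : nat)
    (B : 'M[C]_(m, p)) (X : 'M[C]_(m, n)) :
  colspace_sub X B -> orthoproj B *m X = X.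
Proof.
move=> /submxP[D XD].
have -> : X = B *m D^T by apply: trmx_inj; rewrite XD trmx_mul trmxK.
have /and4P[/eqP BB _ _ _] := mpinvP B.
by rewrite mulmxA BB.
Qed.

Lemma colspace_sub_orthoproj (C : numClosedFieldType) (m n p : nat)
    (B : 'M[C]_(m, p)) (X : 'M[C]_(m, n)) :
  colspace_sub (orthoproj B *m X) B.
Proof. by rewrite /colspace_sub /orthoproj -mulmxA trmx_mul submxMl. Qed.

Theorem theorem3p1 (R : realType) (m n : nat)
    (A : 'M[R[i]]_(m, n)) (W : 'M[R[i]]_(n, m)) (q : nat) (hW : W != 0) :
  let P := orthoproj ((A *m W) ^+ q) in
  let condition (X : 'M[R[i]]_(m, n)) :=
    P *m X = mpinv (W *m A *m W *m P) /\ colspace_sub X ((A *m W) ^+ q) in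
  (exists! X : 'M[R[i]]_(m, n), condition X) /\ condition (wqBT A W q).
Proof.
move=> P condition.
have PZ : P *m wqBT A W q = wqBT A W q by rewrite wqBTE orthoproj_mpinv_core.
have solZ : condition (wqBT A W q).
  split; first by rewrite PZ wqBTE.
  by rewrite -PZ colspace_sub_orthoproj.
split=> //; exists (wqBT A W q); split=> // X [PX subX].
by rewrite wqBTE /wqBT_core -PX; apply: orthoproj_id.
Qed.
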